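(* Let $G$ be a (three-dimensional, orientable) GFT tensor graph, possibly containing passive edges, and let $e$ be an active edge of $G$ which is regular (i.e. neither a bridge nor a self-loop). Then $$\mathcal T_G(x,y,z,t)=\mathcal T_{G-e}(x,y,z,t)+\mathcal T_{G/e}(x,y,z,t),$$ where $G-e$ is obtained from $G$ by deleting $e$, $G/e$ is obtained from $G$ by contracting $e$ in the tensor-graph sense (i.e. $e$ is kept but declared passive), and for any GFT tensor graph $G'$ $$\mathcal T_{G'}(x,y,z,t)=\sum_{H\subset G'} (x-1)^{r(G')-r(H)}\,y^{n(H)}\,z^{k(H)-F(H)+n(H)}\,t^{2\sum_{\mathcal B(H)} g_{\mathcal B(H)}}.$$
   Context: A GFT tensor graph (three-dimensional case) is a graph in which every vertex has valence four (dual to a tetrahedron) and every edge consists of three strands (dual to the three edges of a triangle), with a fixed, twist-free matching of strands at vertices; such graphs are taken to be orientable (their dual simplicial complexes are orientable). Erasing one strand of each edge (the middle strand of vertical edges and the lower strand of horizontal edges in the standard vertex drawing) yields a ribbon graph, the jacket graph, which is in bijection with the tensor graph; rank, nullity, connected components and boundary components of subgraphs are computed on this ribbon graph. Edges are of two kinds: active and passive; deletion and contraction are only applied to active edges, and contracting an edge means turning it from active to passive (its endpoints are not identified). The sum $\sum_{H\subset G'}$ runs over spanning subgraphs $H$ (subsets of edges, with all vertices), where all passive edges of $G'$ are always included in $H$ and the active edges range over all subsets. For a subgraph $A$: $k(A)$ is the number of connected components, $r(A)=V-k(A)$ is the rank ($V$ the number of vertices), $n(A)=|A|-r(A)$ is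 the nullity, and $F(A)$ is the number of boundary components (faces) of $A$ viewed as a ribbon (jacket) graph. A bubble of $H$ is a closed three-dimensional region of the tensor graph $H$ formed by its strands; each bubble $\mathcal B(H)$ is a ribbon graph and its genus $g_{\mathcal B(H)}$ is defined by $2-2g=V-E+F$ (vertices, edges, faces of the bubble). The sum $\sum_{\mathcal B(H)}$ runs over all bubbles of $H$. *)

(* Defs.v *)
From HB Require Import structures.
From mathcomp Require Import all_boot all_order all_algebra all_fingroup.

Set Implicit Arguments.
Unset Strict Implicit.
Unset Printing Implicit Defensive.

Import GRing.Theory.

Local Open Scope ring_scope.

(** A vertex [v] has the four legs [(v, i)], [i : 'I_4 = Z/4], in cyclic order:
    the even legs are the vertical ones, the odd legs the horizontal ones.
    Dually [v] is a tetrahedron and [(v, i)] one of its triangles.  The leg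
    [(v, i)] carries three strand ends [(v, i, j)], [j != i]; the vertex joins
    [(v, i, j)] to [(v, j, i)] (dually: the edge shared by triangles i and j).
    The strand erased in the jacket is the one joining opposite legs,
    [j = i + 2].  The vertex of the tetrahedron opposite to triangle [c] is the
    corner [(v, c)]; it lies on the triangles [(v, i)], [i != c]. *)

(** An edge between [(v, i)] and [(w, i')] joins the strand end [(v, i, j)] to
    [(w, i', glue i i' j)].  This is the matching without twist which respects
    the erasing: i + 1 |-> i' - 1, i + 2 |-> i' + 2, i - 1 |-> i' + 1.  It also
    sends i to i', and it is the identification of the corners of the two
    triangles. *)
Definition glue (i i' j : 'I_4) : 'I_4 := i + i' - j.

Definition glue_perm (i i' : 'I_4) : {perm 'I_4} := perm (@subrI _ (i + i')).

(** Orientability of the dual complex: the tetrahedra, with triangles numbered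
    by 'I_4, can be given signs so that every gluing reverses the orientations
    induced on the two identified triangles, i.e. the product of the two signs
    and of the signature of the gluing permutation is -1. *)
Definition dual_orientable (V E : finType) (end_of : E -> bool -> V * 'I_4)
    (D : {set E}) : Prop :=
  exists o : V -> bool, forall e, e \in D ->
    o (end_of e true).1 (+) o (end_of e false).1
      = ~~ odd_perm (glue_perm (end_of e true).2 (end_of e false).2).

(** [E] is an ambient type of names of edges, of which only those in [edges]
    belong to the graph.  A leg which is not the end of an edge of the graph is
    external (this is how deletion keeps the vertices four-valent). *)
Record tensor_graph (V E : finType) := TensorGraph {
  end_of : E -> bool -> V * 'I_4;
  edges : {set E};
  active : {set E};
  active_sub : active \subset edges;
  end_of_inj : forall e f b c, e \in edges -> f \in edges ->
    end_of e b = end_of f c -> e = f /\ b = c;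
  orientable : dual_orientable end_of edges
}.

Section TensorGraph.

Variables V E : finType.
Implicit Types (G : tensor_graph V E) (H : {set E}).

Definition passive G : {set E} := edges G :\: active G.

Section Delete.
Variables (G : tensor_graph V E) (e : E).

Lemma delete_sub : active G :\ e \subset edges G :\ e.
Proof. exact: setSD (active_sub G). Qed.

Lemma delete_inj f f' b c : f \in edges G :\ e -> f' \in edges G :\ e ->
  end_of G f b = end_of G f' c -> f = f' /\ b = c.
Proof. by move=> /setD1P[_ Gf] /setD1P[_ Gf']; exact: (end_of_inj Gf Gf'). Qed.

Lemma delete_orientable : dual_orientable (end_of G) (edges G :\ e).
Proof.
by have [o oG] := orientable G; exists o => f /setD1P[_ Gf]; exact: oG.
Qed.

Definition delete : tensor_graph V E :=
  TensorGraph delete_sub delete_inj delete_orientable.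

Lemma contract_sub : active G :\ e \subset edges G.
Proof. exact: subset_trans (subD1set _ _) (active_sub G). Qed.

Definition contract : tensor_graph V E :=
  TensorGraph contract_sub (@end_of_inj _ _ G) (orientable G).

End Delete.

(** Connected components, inside [A], of a symmetric relation preserving [A]. *)
Definition components (T : finType) (r : rel T) (A : {set T}) : {set {set T}} :=
  equivalence_partition (connect r) A.

(** [joined G H l l']: some edge of [H] has the two ends [l] and [l']. *)
Definition joined G H : rel (V * 'I_4) := fun l l' =>
  [exists e in H, exists b, (end_of G e b == l) && (end_of G e (~~ b) == l')].

Definition used G H (l : V * 'I_4) : bool :=
  [exists e in H, exists b, end_of G e b == l].

Definition vertex_adj G H : rel V := fun v w =>
  [exists i, exists i', joined G H (v, i) (w, i')].

Definition ncomp G H : nat := #|components (vertex_adj G H) [set: V]|.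

Definition rank G H : int := #|V|%:Z - (ncomp G H)%:Z.

Definition nullity G H : int := #|H|%:Z - rank G H.

Definition jacket_strands : {set V * 'I_4 * 'I_4} :=
  [set s | let: (v, i, j) := s in (j != i) && (j != i + 2)].

(** Along the boundary of the ribbon subgraph: corners of a vertex, sides of the
    edges of [H], and arcs of the vertex disc passing in front of a leg which
    carries no edge of [H] ([glue i i] exchanges i + 1 and i - 1, so that no
    erased strand end is reached from [jacket_strands]). *)
Definition boundary_adj G H : rel (V * 'I_4 * 'I_4) := fun s s' =>
  let: (v, i, j) := s in let: (w, i', j') := s' in
  [|| (s' == (v, j, i)),
      joined G H (v, i) (w, i') && (j' == glue i i' j) |
      ~~ used G H (v, i) && (s' == (v, i, glue i i j))].

Definition nfaces G H : nat := #|components (boundary_adj G H) jacket_strands|.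

(** The vertices of a bubble are corners of tetrahedra (three-valent vertices,
    with one ribbon half-edge in each leg other than c); its ribbon edges are
    the corners of the triangles dual to the edges of [H], each bounded by two
    of the three strands. *)
Definition corner_adj G H : rel (V * 'I_4) := fun p q =>
  let: (v, c) := p in let: (w, c') := q in
  [exists i, exists i',
    [&& i != c, joined G H (v, i) (w, i') & c' == glue i i' c]].

(** Only closed regions are bubbles: no strand runs into a leg without edge. *)
Definition closed_region G H (B : {set V * 'I_4}) : bool :=
  [forall p in B, forall i, (i != p.2) ==> used G H (p.1, i)].

Definition bubbles G H : {set {set V * 'I_4}} :=
  [set B in components (corner_adj G H) [set: V * 'I_4] | closed_region G H B].

Definition bubble_edges G H (B : {set V * 'I_4}) : {set E * 'I_4} :=
  [set p | let: (e, c) := p in let: (v, i) := end_of G e true in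
           [&& e \in H, c != i & (v, c) \in B]].

(** The strand end (v, i, j), seen from the corner (v, c), c != i, j. *)
Definition bubble_strands (B : {set V * 'I_4}) :
    {set (V * 'I_4) * ('I_4 * 'I_4)} :=
  [set s | let: (p, (i, j)) := s in (p \in B) && uniq [:: p.2; i; j]].

Definition strand_adj G H : rel ((V * 'I_4) * ('I_4 * 'I_4)) := fun s s' =>
  let: ((v, c), (i, j)) := s in let: ((w, c'), (i', j')) := s' in
  (s' == ((v, c), (j, i))) ||
  [&& joined G H (v, i) (w, i'), c' == glue i i' c & j' == glue i i' j].

Definition bubble_faces G H (B : {set V * 'I_4}) :=
  components (strand_adj G H) (bubble_strands B).

Definition euler_char G H (B : {set V * 'I_4}) : int :=
  #|B|%:Z - #|bubble_edges G H B|%:Z + #|bubble_faces G H B|%:Z.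

(** 2 - 2 g = V - E + F; the division is exact, a bubble being a closed
    orientable surface (the link of a vertex of the dual complex). *)
Definition genus G H (B : {set V * 'I_4}) : int :=
  ((2 - euler_char G H B) %/ 2)%Z.

Definition bridge G (e : E) : bool :=
  (ncomp G (edges G) < ncomp G (edges G :\ e))%N.

Definition self_loop G (e : E) : bool :=
  (end_of G e true).1 == (end_of G e false).1.

Definition regular G (e : E) : bool := ~~ bridge G e && ~~ self_loop G e.

Definition spanning_subgraph G H : bool :=
  (passive G \subset H) && (H \subset edges G).

(** The polynomial, evaluated in an arbitrary ring (for instance at the
    indeterminates of a polynomial ring).  The exponents, which are all
    nonnegative, are computed in [int] so that no subtraction is truncated. *)
Definition T_poly (R : comUnitRingType) G (x y z t : R) : R :=
  \sum_(H : {set E} | spanning_subgraph G H)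
    (x - 1) ^ (rank G (edges G) - rank G H)
    * y ^ nullity G H
    * z ^ ((ncomp G H)%:Z - (nfaces G H)%:Z + nullity G H)
    * t ^ (2 * \sum_(B in bubbles G H) genus G H B).

End TensorGraph.

(* Main.v *)
Require Import Defs.
From HB Require Import structures.
From mathcomp Require Import all_boot all_order all_algebra.

Local Open Scope ring_scope.

(** Split the sum over the spanning subgraphs H of G according to whether e lies in H. Because e is
    active, those avoiding e are the spanning subgraphs of G - e, and those containing e are the
    ones of G/e, where e has become passive ([spanning_subgraph_delete],
    [spanning_subgraph_contract]). The summand depends on the ambient graph only through its rank,
    which contraction keeps trivially and deletion keeps since e is not a bridge
    ([rank_nonbridge]). *)

Lemma leq_card_components (T : finType) (r r' : rel T) (A : {set T}) :
  subrel r r' -> connect_sym r' -> (#|components r' A| <= #|components r A|)%N.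
Proof.
move=> rr' r'C.
(* [f] saturates a class under [r']: since [r] refines [r'], it sends the [r]-class of x to the
   [r']-class of x, so every [r']-class is in its image. *)
pose f (B : {set T}) := \bigcup_(x in B) [set y in A | connect r' x y].
suff /subset_leq_card/leq_trans: components r' A \subset f @: components r A.
  by apply; exact: leq_imset_card.
apply/subsetP => _ /imsetP[x Ax ->].
apply/imsetP; exists [set y in A | connect r x y]; first exact: imset_f.
apply/setP => y; apply/idP/bigcupP => [xy | [u]].
  by exists x; rewrite // inE Ax connect0.
rewrite !inE => /andP[_ xu] /andP[-> uy] /=.
by apply: connect_trans uy; apply: (connect_sub _ xu) => a b /rr' /connect1.
Qed.

Section DeletionContraction.

Variables V E : finType.
Implicit Types (G : tensor_graph V E) (H : {set E}) (e : E).

Lemma joinedC G H l l' : joined G H l l' = joined G H l' l.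
Proof.
by apply/existsP/existsP => -[e /andP[He /existsP[b /andP[lb lb']]]];
  exists e; rewrite He; apply/existsP; exists (~~ b); rewrite negbK lb lb'.
Qed.

Lemma vertex_adjC G H v w : vertex_adj G H v w = vertex_adj G H w v.
Proof.
by apply/existsP/existsP => -[i /existsP[i' ii']]; exists i';
  apply/existsP; exists i; rewrite joinedC.
Qed.

Lemma vertex_adjS G H H' :
  H \subset H' -> subrel (vertex_adj G H) (vertex_adj G H').
Proof.
move=> /subsetP sHH' v w /existsP[i /existsP[i' /existsP[e /andP[He ends]]]].
apply/existsP; exists i; apply/existsP; exists i'; apply/existsP; exists e.
by rewrite sHH'.
Qed.

Lemma ncompS G H H' : H \subset H' -> (ncomp G H' <= ncomp G H)%N.
Proof.
move=> sHH'; apply: leq_card_components; first exact: vertex_adjS.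
by apply: sym_connect_sym => v w; exact: vertex_adjC.
Qed.

(** Removing an edge never lowers the number of components, and removing a non-bridge does not raise
    it. *)
Lemma rank_nonbridge G e :
  ~~ bridge G e -> rank G (edges G :\ e) = rank G (edges G).
Proof.
rewrite /bridge -leqNgt /rank => le_ncomp; congr (_ - Posz _).
by apply/eqP; rewrite eqn_leq le_ncomp ncompS // subD1set.
Qed.

Lemma spanning_subgraph_contract G e H : e \in active G ->
  spanning_subgraph (contract G e) H = spanning_subgraph G H && (e \in H).
Proof.
move=> Ge; rewrite /spanning_subgraph /passive /=.
have -> : edges G :\: (active G :\ e) = e |: (edges G :\: active G).
  apply/setP => f; rewrite !inE; case: eqVneq => //= ->.
  by rewrite (subsetP (active_sub G)).
by rewrite subUset sub1set -andbA andbC -andbA.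
Qed.

Lemma spanning_subgraph_delete G e H : e \in active G ->
  spanning_subgraph (delete G e) H = spanning_subgraph G H && (e \notin H).
Proof.
move=> Ge; rewrite /spanning_subgraph /passive /=.
have -> : (edges G :\ e) :\: (active G :\ e) = edges G :\: active G.
  by apply/setP => f; rewrite !inE; case: eqVneq => //= ->; rewrite Ge.
by rewrite subsetD1 andbA.
Qed.

End DeletionContraction.

(* The invariants of a spanning subgraph only involve the incidence [end_of],
   which deletion and contraction leave unchanged, so the summands agree up to
   the rank of the ambient graph. *)
Theorem theorem3 (V E : finType) (G : tensor_graph V E) (e : E)
    (e_active : e \in active G) (e_regular : regular G e)
    (R : comUnitRingType) (x y z t : R) :
  T_poly G x y z t = T_poly (delete G e) x y z t + T_poly (contract G e) x y z t.
Proof.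
have /andP[not_bridge _] := e_regular.
rewrite /T_poly (bigID (fun H : {set E} => e \notin H)) /=.
congr (_ + _).
  apply: eq_big => [H | H _]; first by rewrite spanning_subgraph_delete.
  by rewrite -(rank_nonbridge _ _ _ _ not_bridge).
(* Contraction keeps [edges], so the summands already agree by conversion and only the index sets
   need comparing. *)
by apply: eq_bigl => H; rewrite negbK spanning_subgraph_contract.
Qed.
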